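(* Consider a sequence $(\widehat{\mathcal Q}_n^*,M_n)_{n\ge1}$ of randomized selection procedures and models. Suppose that the selective likelihood ratios satisfy, for some $p>1$ and some constant $C$, $$\limsup_n\sup_{\mathbb F_n\in M_n}\|\ell_{\mathbb F_n}\|_{L^p(\mathbb F_n)}<C.$$ Let $\frac1p+\frac1q=1$. Then any sequence of estimators $\hat\theta_n$ which is uniformly consistent for $\theta_n(\mathbb F_n)$ in $L^\alpha$ under $(M_n)_{n\ge1}$ is also uniformly consistent for $\theta_n(\mathbb F_n)$ in $L^\gamma$ under the sequence of selective models $(M_n^* )_{n\ge1}$, for $\gamma\le\alpha/q$. Further, if $\hat\theta_n$ is uniformly consistent for $\theta_n$ in probability under $(M_n)_{n\ge1}$, then $\hat\theta_n$ is uniformly consistent for $\theta_n$ in probability under the sequence $(M_n^* )_{n\ge1}$.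
   Context: For each $n$, data $D_n$ lie in a measurable space $\mathcal D_n$, and $M_n$ is a collection of probability distributions $\mathbb F_n$ on $\mathcal D_n$. A randomized selection procedure $\widehat{\mathcal Q}_n^*(D_n,\omega)$ is a set-valued map depending on the data and an independent auxiliary random element $\omega\sim\mathbb Q$, with $M_n$ in its range. For $\mathbb F_n\in M_n$ the selective distribution $\mathbb F_n^*$ is the law of $D_n$ given $\{M_n\in\widehat{\mathcal Q}_n^*(D_n,\omega)\}$ under $(D_n,\omega)\sim\mathbb F_n\times\mathbb Q$; its density with respect to $\mathbb F_n$ is the selective likelihood ratio $$\ell_{\mathbb F_n}(D)=\frac{d\mathbb F_n^*}{d\mathbb F_n}(D)=\frac{\mathbb W(M_n;D)}{\mathbb E_{\mathbb F_n}[\mathbb W(M_n;D)]},\qquad \mathbb W(M_n;D)=\mathbb Q(\{\omega:M_n\in\widehat{\mathcal Q}_n^*(D,\omega)\}).$$ The selective model is $M_n^*=\{\mathbb F_n^*:\mathbb F_n\in M_n\}$. $\theta_n:M_n\to\mathbb R$ is a functional, $\hat\theta_n:\mathcal D_n\to\mathbb R$ an estimator. The target under $\mathbb F_n^*$ is still $\theta_n(\mathbb F_n)$ (a functional of $\mathbb F_n$, not of $\mathbb F_n^*$). Uniform consistency in $L^r$ under $(M_n)$: $\limsup_n\sup_{\mathbb F_n\in M_n}\|\hat\theta_n-\theta_n(\mathbb F_n)\|_{L^r(\mathbb F_n)}=0$. Uniform consistency in probability under $(M_n)$: for every $\epsilon>0$ there exists $\delta(\epsilon)>0$ such that for all $\delta\ge\delta(\epsilon)$,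 $\limsup_n\sup_{\mathbb F_n\in M_n}\mathbb F_n(|\hat\theta_n-\theta_n(\mathbb F_n)|>\delta)\le\epsilon$. The corresponding notions under $(M_n^* )$ are obtained by replacing the laws $\mathbb F_n$ in the $L^r$ norm, respectively in the probability, by $\mathbb F_n^*$, with the same target $\theta_n(\mathbb F_n)$. *)

(* Defs.v *)
From HB Require Import structures.
From mathcomp Require Import all_boot all_order all_algebra.
From mathcomp Require Import all_classical all_reals all_analysis.
From mathcomp Require Import measurable_realfun.

Set Implicit Arguments.
Unset Strict Implicit.
Unset Printing Implicit Defensive.
Import Order.TTheory GRing.Theory Num.Theory.
Import numFieldNormedType.Exports.

Local Open Scope classical_set_scope.
Local Open Scope ring_scope.

Definition model d (T : measurableType d) (R : realType) : Type :=
  set (probability T R).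

HB.instance Definition _ d1 d2 (T1 : measurableType d1)
    (T2 : measurableType d2) :=
  isMeasurableFun.Build _ _ _ _ (@fst T1 T2) measurable_fst.

(* The law [P( . | E)]. It is the conditional law when [0 < P E]; for
   [P E = 0], [mnormalize] returns its default argument [P]. *)
Definition cond_law d (T : measurableType d) (R : realType)
    (P : probability T R) (E : set T) (mE : measurable E) : probability T R :=
  mnormalize (mrestr P mE) P.

Lemma cond_lawE d (T : measurableType d) (R : realType)
    (P : probability T R) (E : set T) (mE : measurable E) (A : set T) :
  (0 < P E -> cond_law P mE A = P (A `&` E) * (fine (P E))^-1%:E)%E.
Proof.
move=> E0; have Ey : (P E < +oo)%E.
  by apply: le_lt_trans (probability_le1 P mE) (ltry 1).
have PE : ((P (setT `&` E) == 0) || (P (setT `&` E) == +oo))%E = false.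
  by rewrite setTI gt_eqF//= lt_eqF.
rewrite /cond_law /= /mnormalize ifF; last exact: PE.
transitivity (P (A `&` E) * (fine (P (setT `&` E)))^-1%:E)%E.
  exact: erefl.
by rewrite setTI.
Qed.

Section selection.
Context d e (T : measurableType d) (Omega : measurableType e) (R : realType).
Variables (Q : probability Omega R) (Qhat : T -> Omega -> set (model T R)).
Variable M : model T R.

Definition sel_event : set (T * Omega) := [set x | Qhat x.1 x.2 M].

Definition sel_weight (x : T) : R := fine (Q [set w | Qhat x w M]).

Definition sel_lr (F : probability T R) (x : T) : R :=
  sel_weight x / fine 'E_F[sel_weight]%E.

Definition sel_dist (mE : measurable sel_event) (F : probability T R) :
    probability T R :=
  distribution (cond_law (F \x Q)%E mE) fst.

End selection.

Section sel_density.
Context d e (T : measurableType d) (Omega : measurableType e) (R : realType).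
Variables (Q : probability Omega R) (Qhat : T -> Omega -> set (model T R)).
Variables (M : model T R) (mE : measurable (sel_event Qhat M)).
Variable F : probability T R.
Local Open Scope ereal_scope.

Lemma sel_weightE x :
  (sel_weight Q Qhat M x)%:E = Q (xsection (sel_event Qhat M) x).
Proof.
rewrite (_ : xsection _ _ = [set w | Qhat x w M]); last first.
  by apply/seteqP; split => w; rewrite /xsection /= inE.
rewrite fineK// ge0_fin_numE//; apply: le_lt_trans (ltry 1).
rewrite probability_le1//.
rewrite (_ : [set w | _] = xsection (sel_event Qhat M) x).
  exact: measurable_xsection.
by apply/seteqP; split => w; rewrite /xsection /= inE.
Qed.

Lemma measurable_sel_weight : measurable_fun setT (sel_weight Q Qhat M).
Proof.
apply/measurable_EFinP.
rewrite (_ : _ \o _ = Q \o xsection (sel_event Qhat M)).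
  exact: measurable_fun_xsection.
by apply/funext => x; rewrite /= sel_weightE.
Qed.

Lemma expectation_sel_weight :
  'E_F[sel_weight Q Qhat M] = (F \x Q) (sel_event Qhat M).
Proof.
by rewrite unlock; apply: eq_integral => x _; rewrite sel_weightE.
Qed.

Lemma sel_dist_density (A : set T) : measurable A ->
  0 < (F \x Q) (sel_event Qhat M) ->
  sel_dist Q mE F A = \int[F]_(x in A) (sel_lr Q Qhat M F x)%:E.
Proof.
move=> mA E0.
have -> : sel_dist Q mE F A = cond_law (F \x Q) mE (fst @^-1` A) by [].
rewrite (cond_lawE mE (fst @^-1` A) E0).
rewrite /sel_lr expectation_sel_weight.
under eq_integral do rewrite EFinM.
rewrite ge0_integralZr//; first 1 last.
- by apply/measurable_EFinP; apply: measurable_funS measurable_sel_weight.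
- by move=> x _; rewrite lee_fin fine_ge0.
- by rewrite lee_fin invr_ge0 fine_ge0.
congr (_ * _); rewrite [RHS]integral_mkcond; apply: eq_integral => x _ /=.
rewrite patchE sel_weightE.
case: ifPn => [|]; rewrite ?inE ?notin_setE => xA.
  congr (Q _); apply/seteqP; split => w; rewrite /xsection /= !inE /=.
    by case.
  by [].
rewrite (_ : xsection _ _ = set0) ?measure0//.
by apply/seteqP; split => w//; rewrite /xsection /= inE => -[].
Qed.

End sel_density.

(* In the next two definitions [law n F] is the law under which the error is
   measured, while the target is [theta n F] in all cases. The identity gives
   the notions under [(M_n)], and the map [F |-> F*] the notions under the
   models [{F* : F in M_n}]. *)
Definition unif_consistent_L (R : realType) (d : nat -> measure_display)
    (D : forall n, measurableType (d n)) (M : forall n, model (D n) R)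
    (law : forall n, probability (D n) R -> probability (D n) R)
    (theta : forall n, probability (D n) R -> R)
    (thetahat : forall n, {mfun D n >-> R}) (r : R) : Prop :=
  (limn_esup (fun n => ereal_sup
     [set 'N[law n F]_r%:E [(fun x => (thetahat n x - theta n F)%:E)]
     | F in M n]) = 0)%E.

Definition unif_consistent_prob (R : realType) (d : nat -> measure_display)
    (D : forall n, measurableType (d n)) (M : forall n, model (D n) R)
    (law : forall n, probability (D n) R -> probability (D n) R)
    (theta : forall n, probability (D n) R -> R)
    (thetahat : forall n, {mfun D n >-> R}) : Prop :=
  forall eps : R, 0 < eps -> exists2 delta0 : R, 0 < delta0 &
    forall delta : R, delta0 <= delta ->
      (limn_esup (fun n => ereal_sup
         [set law n F [set x | (delta < `|thetahat n x - theta n F|)%R]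
         | F in M n]) <= eps%:E)%E.

(* Main.v *)
Require Import Defs.
From HB Require Import structures.
From mathcomp Require Import all_boot all_order all_algebra.
From mathcomp Require Import all_classical all_reals all_analysis.
Import Order.TTheory GRing.Theory Num.Theory.
From mathcomp Require Import measurable_realfun.
Import numFieldNormedType.Exports.
Local Open Scope classical_set_scope.
Local Open Scope ring_scope.

(** The selective law [S] of [F] has density [l = sel_lr] with respect to [F],
    and the [L^p(F)] norm of [l] is bounded uniformly in [F] and in large [n].
    Hoelder's inequality therefore transfers smallness of an [F]-integral to
    the corresponding [S]-integral: for every measurable [g >= 0],
    [int g dS = int l g dF <= |l|_{L^p(F)} * |g|_{L^q(F)}]
    ([integral_density_hoelder]).  The two claims are two choices of [g].

    - For [g = |X|^gamma], where [X] is the estimation error, this yields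
      [|X|_{L^gamma(S)} <= |l|_p^(1/gamma) * |X|_{L^(gamma q)(F)}], and since
      [gamma q <= alpha] and [F] has mass one, the last norm is at most
      [|X|_{L^alpha(F)}] ([Lnorm_density]).
    - For [g] the indicator of an event [A], it yields
      [S(A) <= |l|_p * F(A)^(1/q)] ([probability_density]), so that [A] is
      [S]-unlikely as soon as it is [F]-unlikely.

    Both bounds hold for each [F] separately with the same constant, hence
    they survive the supremum over [F] in the model and the limsup in [n].

    A model may be empty, in which case the supremum over it is [-oo].  The
    limsup of the [L^gamma(S)] errors is nevertheless at least [0]: otherwise
    the models would be empty for all large [n], and the limsup of the
    [L^alpha(F)] errors, which is [0], would be [-oo] too. *)

Section power_norms.
Context {d : measure_display} {T : measurableType d} {R : realType}.
Implicit Types (P : probability T R) (f : T -> R) (r s : R).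
Local Open Scope ereal_scope.

Lemma ge0_le_poweR (x y : \bar R) r :
  (0 <= r)%R -> 0 <= x -> x <= y -> x `^ r <= y `^ r.
Proof.
move=> r0 x0 xy; apply: gt0_ler_poweR => //; rewrite in_itv /= leey andbT//.
exact: le_trans xy.
Qed.

Lemma measurable_norm_powR f r : measurable_fun [set: T] f ->
  measurable_fun [set: T] (fun x => `|f x| `^ r)%R.
Proof.
move=> mf; apply: (@measurableT_comp _ _ _ _ _ _ (@powR R ^~ r)) => //.
exact: measurableT_comp.
Qed.

Lemma Lnorm_norm_powR P f r s : s != 0%R ->
  'N[P]_(s%:E)[(fun x => (`|f x| `^ r)%:E)] =
  'N[P]_((r * s)%:E)[EFin \o f] `^ r.
Proof.
move=> s0; have [->|r0] := eqVneq r 0%R.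
  rewrite poweRe0 -[RHS](poweR1r s^-1) -(probability_setT P) -Lnorm_cst1.
  by apply: eq_Lnorm => x; rewrite powRr0.
rewrite unlock; under eq_integral do
  rewrite abse_EFin ger0_norm ?powR_ge0// poweR_EFin -powRrM.
rewrite -poweRrM; congr (_ `^ _).
by rewrite invfM mulrAC mulVf ?mul1r.
Qed.

(** Lyapunov's inequality: Hoelder's inequality for the product of [|f|^r] and
    the constant [1], with exponent [s / r] on the first factor.  The second
    factor has norm [1] because [P] has mass one. *)
Lemma le_Lnorm_exponent P f r s : measurable_fun [set: T] f ->
  (0 < r)%R -> (r <= s)%R ->
  'N[P]_(r%:E)[EFin \o f] <= 'N[P]_(s%:E)[EFin \o f].
Proof.
move=> mf r0; rewrite le_eqVlt => /predU1P[->//|rs].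
have s0 := lt_trans r0 rs.
have t0 : (0 < s / r)%R by rewrite divr_gt0.
have u0 : (0 < (1 - (s / r)^-1)^-1)%R.
  by rewrite invr_gt0 subr_gt0 invf_div ltr_pdivrMr// mul1r.
have tu : ((s / r)^-1 + (1 - (s / r)^-1)^-1^-1 = 1)%R by rewrite invrK subrKC.
have m1 : measurable_fun [set: T] (@cst T R 1%R) by exact: measurable_cst.
have := hoelder P (measurable_norm_powR f r mf) m1 t0 u0 tu.
rewrite (eq_Lnorm _ _ (g := fun x => (`|f x| `^ r)%:E)); last first.
  by move=> x /=; rewrite mulr1.
rewrite (Lnorm_norm_powR P f r 1) ?oner_neq0// mulr1.
rewrite (Lnorm_norm_powR P f r (s / r)) ?gt_eqF//.
rewrite Lnorm_cst1 [X in _ * (X `^ _)]probability_setT poweR1r mule1.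
rewrite mulrCA divff ?gt_eqF// mulr1.
move=> /(ge0_le_poweR _ _ r^-1); rewrite invr_ge0 ltW// poweR_ge0.
by rewrite -!poweRrM divff ?gt_eqF// !poweRe1 ?Lnorm_ge0//; apply.
Qed.

End power_norms.

Section change_of_law.
Context {d : measure_display} {T : measurableType d} {R : realType}.
Variables (P S : probability T R) (w : T -> R).
Hypothesis mw : measurable_fun [set: T] w.
Hypothesis w0 : forall x, 0 <= w x.
Hypothesis Sw : forall A, measurable A -> S A = (\int[P]_(x in A) (w x)%:E)%E.
Local Open Scope ereal_scope.

(** The Radon-Nikodym derivative of [S] has the same integral as [w] over every
    measurable set, so the two agree [P]-almost everywhere; the identity then
    follows from the change of variables for the derivative. *)
Lemma ge0_integral_density (f : T -> \bar R) :
  (forall x, 0 <= f x) -> measurable_fun [set: T] f ->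
  \int[S]_x f x = \int[P]_x (f x * (w x)%:E).
Proof.
move=> f0 mf.
have mEw : measurable_fun [set: T] (EFin \o w) by exact/measurable_EFinP.
have iw : P.-integrable [set: T] (EFin \o w).
  apply/integrableP; split => //; under eq_integral do rewrite /= ger0_norm//.
  by rewrite -Sw//; apply: le_lt_trans (ltry 1); rewrite probability_le1.
have SP : S `<< P.
  apply/null_content_dominatesP => A mA PA; rewrite Sw//.
  by apply: null_set_integral => //; exact: measurable_funTS.
have ig := Radon_Nikodym_SigmaFinite.f_integrable SP.
have wg : ae_eq P setT (EFin \o w) (Radon_Nikodym_SigmaFinite.f S P).
  apply: integral_ae_eq => //; first exact: measurable_int ig.
  move=> A _ mA; rewrite -(Radon_Nikodym_SigmaFinite.f_integral SP)//.
  exact/esym/Sw.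
rewrite -(Radon_Nikodym_SigmaFinite.change_of_variables SP)//.
apply: ae_eq_integral => //.
- by apply: emeasurable_funM => //; exact: measurable_int ig.
- exact: emeasurable_funM.
- by case: wg => N [mN PN wgN]; exists N; split => // x /= h; apply: wgN => /= h';
    apply: h => _; rewrite h'.
Qed.

Context {p q : R}.
Hypothesis (p0 : (0 < p)%R) (q0 : (0 < q)%R) (pq : (p^-1 + q^-1 = 1)%R).

Lemma integral_density_hoelder (g : T -> R) :
  (forall x, (0 <= g x)%R) -> measurable_fun [set: T] g ->
  \int[S]_x (g x)%:E <= 'N[P]_(p%:E)[EFin \o w] * 'N[P]_(q%:E)[EFin \o g].
Proof.
move=> g0 mg; apply: le_trans (hoelder P mw mg p0 q0 pq).
rewrite Lnorm1 ge0_integral_density//; last exact/measurable_EFinP.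
rewrite le_eqVlt; apply/orP; left; apply/eqP/eq_integral => x _ /=.
by rewrite ger0_norm ?mulr_ge0// muleC.
Qed.

(** The previous bound for [g = |f|^r], whose [L^q] norm is the [r]-th power of
    the [L^(r q)] norm of [f]; the exponent is then raised from [r q] to [s]. *)
Lemma Lnorm_density (f : T -> R) (r s : R) : measurable_fun [set: T] f ->
  (0 < r)%R -> (r * q <= s)%R ->
  'N[S]_(r%:E)[EFin \o f] <=
  'N[P]_(p%:E)[EFin \o w] `^ r^-1 * 'N[P]_(s%:E)[EFin \o f].
Proof.
move=> mf r0 rqs.
apply: (@le_trans _ _
  ('N[P]_(p%:E)[EFin \o w] `^ r^-1 * 'N[P]_((r * q)%:E)[EFin \o f])).
  have /(ge0_le_poweR _ _ r^-1) := integral_density_hoelder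
    (fun x => `|f x| `^ r)%R (fun x => powR_ge0 _ _) (measurable_norm_powR f r mf).
  rewrite Lnorm_norm_powR ?gt_eqF// poweRM ?poweR_ge0 ?Lnorm_ge0//.
  rewrite -poweRrM divff ?gt_eqF// poweRe1 ?Lnorm_ge0// invr_ge0 ltW//.
  by rewrite [in X in _ -> X <= _]unlock; apply => //;
    apply: integral_ge0 => x _; rewrite lee_fin powR_ge0.
by rewrite lee_wpmul2l ?poweR_ge0// le_Lnorm_exponent// mulr_gt0.
Qed.

Lemma probability_density (A : set T) : measurable A ->
  S A <= 'N[P]_(p%:E)[EFin \o w] * P A `^ q^-1.
Proof.
move=> mA; rewrite -[S A](congr1 S (setIT A)) -integral_indic//.
apply: le_trans (integral_density_hoelder \1_A _ _) _ => //.
rewrite lee_wpmul2l ?Lnorm_ge0// unlock.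
rewrite (_ : \int[P]_x _ = P A)//; rewrite -[in RHS](setIT A) -integral_indic//.
apply: eq_integral => x _; rewrite /= ger0_norm// indicE.
by case: (x \in A); rewrite ?powR1// powR0 ?gt_eqF.
Qed.

End change_of_law.

Section limsup.
Context {R : realType}.
Implicit Types (u : (\bar R)^nat) (c : \bar R).
Local Open Scope ereal_scope.

(** This lemma and the next one replace a limsup by a bound valid for all
    large [n], which is the form in which the inequalities above apply. *)
Lemma limn_esup_lt u c : limn_esup u < c -> \forall n \near \oo, u n < c.
Proof.
rewrite /limn_esup limf_esupE => /ereal_inf_lt[_ [V FV <-]] Vc.
apply: filterS FV => n Vn; apply: le_lt_trans Vc.
by apply: ereal_sup_ubound; exists n.
Qed.

Lemma limn_esup_le u c : (\forall n \near \oo, u n <= c) -> limn_esup u <= c.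
Proof.
move=> uc; rewrite /limn_esup limf_esupE.
apply: (@le_trans _ _ (ereal_sup (u @` [set n | u n <= c]))).
  by apply: ereal_inf_lbound; exists [set n | u n <= c].
by apply: ge_ereal_sup => _ [n /= ? <-].
Qed.

End limsup.

Section selective_law.
Context {d e : measure_display} {T : measurableType d}
  {Omega : measurableType e} {R : realType}.
Variables (Q : probability Omega R) (Qhat : T -> Omega -> set (model T R)).
Variables (M : model T R) (mE : measurable (sel_event Qhat M)).
Variable F : probability T R.

Lemma sel_lr_ge0 x : 0 <= sel_lr Q Qhat M F x.
Proof.
rewrite /sel_lr divr_ge0 ?fine_ge0// (expectation_sel_weight Q mE F).
exact: measure_ge0.
Qed.

Lemma measurable_sel_lr : measurable_fun [set: T] (sel_lr Q Qhat M F).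
Proof.
by apply: measurable_funM; [exact: measurable_sel_weight|exact: measurable_cst].
Qed.

End selective_law.

Theorem lemma3 (R : realType) (d e : nat -> measure_display)
    (D : forall n, measurableType (d n))
    (Omega : forall n, measurableType (e n))
    (Q : forall n, probability (Omega n) R)
    (Qhat : forall n, D n -> Omega n -> set (model (D n) R))
    (M : forall n, model (D n) R)
    (M_range : forall n, exists x w, Qhat n x w (M n))
    (mE : forall n, measurable (sel_event (Qhat n) (M n)))
    (E_gt0 : forall n F, M n F ->
       (0 < (F \x Q n) (sel_event (Qhat n) (M n)))%E)
    (theta : forall n, probability (D n) R -> R)
    (p q C : R) (p_gt1 : 1 < p) (pq : p^-1 + q^-1 = 1)
    (lr_bound : (limn_esup (fun n => ereal_sup
       [set 'N[F]_p%:E [EFin \o sel_lr (Q n) (Qhat n) (M n) F] | F in M n])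
       < C%:E)%E) :
  (forall alpha gamma : R, 0 < alpha -> 0 < gamma -> gamma <= alpha / q ->
   forall thetahat : forall n, {mfun D n >-> R},
     unif_consistent_L M (fun n F => F) theta thetahat alpha ->
     unif_consistent_L M (fun n => sel_dist (Q n) (mE n)) theta thetahat gamma)
  /\
  (forall thetahat : forall n, {mfun D n >-> R},
     unif_consistent_prob M (fun n F => F) theta thetahat ->
     unif_consistent_prob M (fun n => sel_dist (Q n) (mE n)) theta thetahat).
Proof.
(* [C] itself need not be positive: if the models are empty for large [n], the
   limsup of the norms is [-oo]. *)
pose K := Num.max C 1.
have K0 : 0 < K by rewrite /K lt_max ltr01 orbT.
have p0 : 0 < p := lt_trans ltr01 p_gt1.
have q0 : 0 < q.
  by rewrite -invr_gt0 -(addKr p^-1 q^-1) pq addrC subr_gt0 invf_lt1.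
have lrK : \forall n \near \oo, forall F, M n F ->
    ('N[F]_p%:E [EFin \o sel_lr (Q n) (Qhat n) (M n) F] <= K%:E)%E.
  apply: filterS (limn_esup_lt _ _ lr_bound) => n ltC F MF.
  apply: (@le_trans _ _ C%:E); last by rewrite lee_fin /K le_max lexx.
  by apply/ltW/(le_lt_trans _ ltC)/ereal_sup_ubound; exists F.
have density n F : M n F -> forall A, measurable A ->
    sel_dist (Q n) (mE n) F A =
    (\int[F]_(x in A) (sel_lr (Q n) (Qhat n) (M n) F x)%:E)%E.
  by move=> MF A mA; apply: sel_dist_density => //; exact: E_gt0.
have merr n c (thetahat : {mfun D n >-> R}) :
    measurable_fun [set: D n] (fun x => thetahat x - c).
  exact: measurable_funB.
split.
- move=> alpha gamma alpha0 gamma0 gamma_le thetahat; rewrite /unif_consistent_L.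
  set a := (X in limn_esup X = _ -> _) => lim_a.
  apply/eqP; rewrite eq_le; apply/andP; split.
    apply/lee_addgt0Pr => eps eps0; rewrite add0e; apply: limn_esup_le.
    have Kg0 : 0 < K `^ gamma^-1 by rewrite powR_gt0.
    have /limn_esup_lt small : (limn_esup a < (eps / K `^ gamma^-1)%:E)%E.
      by rewrite lim_a lte_fin divr_gt0.
    apply: filterS2 lrK small => n lrKn an.
    apply: ge_ereal_sup => _ [F MF <-].
    have gq : gamma * q <= alpha by rewrite -ler_pdivlMr.
    apply: le_trans (Lnorm_density F _ _ (measurable_sel_lr _ _ _ (mE n) F)
      (sel_lr_ge0 _ _ _ (mE n) F) (density n F MF) p0 q0 pq
      _ _ _ (merr n (theta n F) (thetahat n)) gamma0 gq) _.
    rewrite -[in leRHS](divfK (lt0r_neq0 Kg0) eps) mulrC EFinM.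
    apply: lee_pmul; rewrite ?poweR_ge0 ?Lnorm_ge0//.
      rewrite -poweR_EFin; apply: ge0_le_poweR; rewrite ?Lnorm_ge0 ?lrKn//.
      by rewrite invr_ge0 ltW.
    by apply/ltW/(le_lt_trans _ an)/ereal_sup_ubound; exists F.
  (* A negative supremum of norms is a supremum over the empty set, and then
     [a n] is [-oo] as well. *)
  rewrite leNgt; apply/negP => /limn_esup_lt b_neg.
  suff : (limn_esup a <= (-1)%:E)%E by rewrite lim_a lee_fin lerNr oppr0 ler10.
  apply: limn_esup_le; apply: filterS b_neg => n bn.
  apply: ge_ereal_sup => _ [F MF <-]; move: bn; rewrite ltNge => /negP[].
  apply: (le_trans (Lnorm_ge0 (sel_dist (Q n) (mE n) F) gamma%:E
    (fun x => (thetahat n x - theta n F)%:E))).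
  by apply: ereal_sup_ubound; exists F.
- move=> thetahat cons eps eps0.
  (* Chosen so that [K * eta^(1/q) = eps]; the hypothesis is used at [eta / 2]
     because it bounds a limsup only in the wide sense. *)
  pose eta := (eps / K) `^ q.
  have eta0 : 0 < eta by rewrite powR_gt0// divr_gt0.
  have [delta0 delta00 cons0] := cons _ (divr_gt0 eta0 (ltr0Sn R 1)).
  exists delta0 => // delta /cons0 lim_a; apply: limn_esup_le.
  have half_lt : ((eta / 2)%:E < eta%:E)%E.
    by rewrite lte_fin ltr_pdivrMr// ltr_pMr// ltr1n.
  apply: filterS2 lrK (limn_esup_lt _ _ (le_lt_trans lim_a half_lt)) => n lrKn an.
  apply: ge_ereal_sup => _ [F MF <-].
  set A := [set x | _].
  have mA : measurable A.
    rewrite -[A]setTI; apply: measurable_fun_ltr => //.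
    exact: measurableT_comp.
  apply: le_trans (probability_density F _ _ (measurable_sel_lr _ _ _ (mE n) F)
      (sel_lr_ge0 _ _ _ (mE n) F) (density n F MF) p0 q0 pq _ mA) _.
  have -> : eps = K * eta `^ q^-1.
    rewrite /eta -powRrM divff ?gt_eqF// powRr1 ?divr_ge0 ?ltW//.
    by rewrite mulrCA divff ?gt_eqF// mulr1.
  rewrite EFinM; apply: lee_pmul; rewrite ?poweR_ge0 ?Lnorm_ge0 ?lrKn//.
  rewrite -poweR_EFin; apply: ge0_le_poweR => //; first by rewrite invr_ge0 ltW.
  by apply/ltW/(le_lt_trans _ an)/ereal_sup_ubound; exists F.
Qed.
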